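(* Let $(\Lambda,\phi,\alpha)$ be a smooth solution on $[0,\infty)\times\mathbb{R}$ of $$\begin{cases}\partial_t(\alpha\,\partial_t\Lambda)-\partial_x(\alpha\,\partial_x\Lambda)=2\alpha\sinh(2\Lambda)\big((\partial_t\phi)^2-(\partial_x\phi)^2\big),\\ \partial_t(\alpha\sinh^2\Lambda\,\partial_t\phi)-\partial_x(\alpha\sinh^2\Lambda\,\partial_x\phi)=0,\\ \partial_t^2\alpha-\partial_x^2\alpha=0,\end{cases}$$ such that for all $(t,x)\in[0,\infty)\times\mathbb{R}$, $$\alpha(t,x)>0,\qquad\partial_t\alpha(t,x)>0,\qquad(\partial_x\alpha)^2(t,x)-(\partial_t\alpha)^2(t,x)<0.$$ Then the modified energy $$E[\Lambda,\phi;\alpha](t)=-\int_{\mathbb{R}}\kappa\,\big(\partial_t\alpha\,h_1-2\,\partial_x\alpha\,h_2\big)(t,x)\,dx$$ is well-defined (as an element of $[0,+\infty]$) and nonnegative.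
   Context: Here $$\kappa=\frac{\alpha}{(\partial_x\alpha)^2-(\partial_t\alpha)^2},\quad h_1=(\partial_t\Lambda)^2+(\partial_x\Lambda)^2+4\sinh^2(\Lambda)\big((\partial_x\phi)^2+(\partial_t\phi)^2\big),\quad h_2=\partial_t\Lambda\,\partial_x\Lambda+4\sinh^2(\Lambda)\,\partial_t\phi\,\partial_x\phi.$$ *)

(* Defs.v *)
From HB Require Import structures.
From mathcomp Require Import all_boot all_order all_algebra.
From mathcomp Require Import all_classical all_reals all_analysis measurable_realfun.
Set Implicit Arguments.
Unset Strict Implicit.
Unset Printing Implicit Defensive.
Import Order.TTheory GRing.Theory Num.Theory.
Import numFieldNormedType.Exports.
Local Open Scope classical_set_scope.
Local Open Scope ring_scope.

Definition sinh {R : realType} (x : R) : R := (expR x - expR (- x)) / 2.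

(* Functions of (t, x) are curried, time first; only their values for
   [0 <= t] are ever inspected. *)
Section HalfPlane.
Context {R : realType}.
Implicit Types f : R -> R -> R.

Definition half_plane : set (R * R) := [set p | 0 <= p.1].

(* Nonzero increments [h] with [0 <= t + h]: the usual punctured neighborhoods
   of 0 when [0 < t], the right ones when [t = 0].  Thus [pdt] is the ordinary
   time derivative for [0 < t] and the one-sided one on the boundary. *)
Definition time_increments (t : R) : set_system R :=
  within [set h | 0 <= t + h] (0 : R)^'.

Definition time_quotient f (t x h : R) : R := h^-1 * (f (t + h) x - f t x).

Definition pdt f (t x : R) : R :=
  lim (time_quotient f t x @ time_increments t).

Definition pdx f (t x : R) : R := derive1 (f t) x.

Definition derivable_t f (t x : R) : Prop :=
  cvg (time_quotient f t x @ time_increments t).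

Definition derivable_x f (t x : R) : Prop := derivable (f t) x 1.

(* Class C^n on the closed half-plane: all iterated partial derivatives of
   order at most n exist and are jointly continuous up to the boundary. *)
Fixpoint smooth_upto (n : nat) f : Prop :=
  {within half_plane, continuous (fun p => f p.1 p.2)} /\
  (if n is m.+1 then
     [/\ forall t x, 0 <= t -> derivable_t f t x /\ derivable_x f t x,
         smooth_upto m (pdt f) & smooth_upto m (pdx f)]
   else True).

Definition smooth f : Prop := forall n, smooth_upto n f.

End HalfPlane.

Section Fields.
Context {R : realType}.
Implicit Types Lambda phi alpha : R -> R -> R.

Definition wave_system Lambda phi alpha : Prop :=
  forall t x : R, 0 <= t ->
  [/\ pdt (fun s y => alpha s y * pdt Lambda s y) t x
      - pdx (fun s y => alpha s y * pdx Lambda s y) t x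
      = 2 * alpha t x * sinh (2 * Lambda t x)
          * (pdt phi t x ^+ 2 - pdx phi t x ^+ 2),
      pdt (fun s y => alpha s y * sinh (Lambda s y) ^+ 2 * pdt phi s y) t x
      - pdx (fun s y => alpha s y * sinh (Lambda s y) ^+ 2 * pdx phi s y) t x
      = 0 &
      pdt (pdt alpha) t x - pdx (pdx alpha) t x = 0].

Definition smooth_solution Lambda phi alpha : Prop :=
  [/\ smooth Lambda, smooth phi, smooth alpha & wave_system Lambda phi alpha].

Definition kappa alpha (t x : R) : R :=
  alpha t x / (pdx alpha t x ^+ 2 - pdt alpha t x ^+ 2).

Definition h1 Lambda phi (t x : R) : R :=
  pdt Lambda t x ^+ 2 + pdx Lambda t x ^+ 2
  + 4 * sinh (Lambda t x) ^+ 2 * (pdx phi t x ^+ 2 + pdt phi t x ^+ 2).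

Definition h2 Lambda phi (t x : R) : R :=
  pdt Lambda t x * pdx Lambda t x
  + 4 * sinh (Lambda t x) ^+ 2 * (pdt phi t x * pdx phi t x).

Definition energy_integrand Lambda phi alpha (t x : R) : R :=
  kappa alpha t x * (pdt alpha t x * h1 Lambda phi t x
                     - 2 * pdx alpha t x * h2 Lambda phi t x).

Definition energy Lambda phi alpha (t : R) : \bar R :=
  (- \int[lebesgue_measure]_(x in [set: R])
       (energy_integrand Lambda phi alpha t x)%:E)%E.

End Fields.

(* The Lebesgue integral of [f] over [D] makes sense in the extended reals:
   [f] is measurable and the difference of the integrals of its positive and
   negative parts is not of the form oo - oo.  This has to be required
   separately because [integral] is a total function. *)
Definition integral_well_defined {d : measure_display} {T : measurableType d}
    {R : realType} (mu : {measure set T -> \bar R}) (D : set T)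
    (f : T -> \bar R) : Prop :=
  measurable_fun D f /\
  ((\int[mu]_(x in D) f^\+ x < +oo)%E \/ (\int[mu]_(x in D) f^\- x < +oo)%E).

(* Main.v *)
Require Import Defs.
From mathcomp Require Import all_boot all_order all_algebra.
From mathcomp Require Import all_classical all_reals all_analysis measurable_realfun.
From mathcomp Require Import ring lra.
Import Order.TTheory GRing.Theory Num.Theory.
Import numFieldNormedType.Exports.
Local Open Scope classical_set_scope.
Local Open Scope ring_scope.

(** The integrand is pointwise nonpositive, so its integral exists in
    [[-oo, 0]] whether or not it converges.  In the null frame, the quantities
    [h1 + 2 h2] and [h1 - 2 h2] are the sums of squares
    [(dt Lambda +- dx Lambda)^2 + 4 sinh^2 Lambda (dt phi +- dx phi)^2], and

      [2 (dt alpha h1 - 2 dx alpha h2)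
         = (dt alpha - dx alpha) (h1 + 2 h2)
           + (dt alpha + dx alpha) (h1 - 2 h2)].

    A timelike gradient of [alpha] with [dt alpha > 0] makes both weights
    [dt alpha -+ dx alpha] positive ([future_timelike_weights]), whereas it makes
    [kappa] negative ([energy_integrand_le0]).  Measurability
    comes from continuity in [x] at fixed [t] ([continuous_energy_integrand]),
    where the denominator of [kappa] never vanishes. *)

Lemma future_timelike_weights (F : realDomainType) (a b : F) :
  0 < a -> b ^+ 2 - a ^+ 2 < 0 -> 0 < a - b /\ 0 < a + b.
Proof.
move=> a0 ba; have : `|b| < a.
  by rewrite -(ger0_norm (ltW a0)) -ltr_sqr ?nnegrE// !real_normK ?num_real// -subr_lt0.
by rewrite ltr_norml => /andP[lb ub]; split; lra.
Qed.

Section Integrand.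
Context {R : realType}.
Implicit Types (Lambda phi alpha f : R -> R -> R) (t x : R).

Lemma h1D2h2_ge0 Lambda phi t x : 0 <= h1 Lambda phi t x + 2 * h2 Lambda phi t x.
Proof.
have -> : h1 Lambda phi t x + 2 * h2 Lambda phi t x =
    (pdt Lambda t x + pdx Lambda t x) ^+ 2
    + (2 * sinh (Lambda t x) * (pdt phi t x + pdx phi t x)) ^+ 2.
  by rewrite /h1 /h2; ring.
by rewrite addr_ge0 ?sqr_ge0.
Qed.

Lemma h1B2h2_ge0 Lambda phi t x : 0 <= h1 Lambda phi t x - 2 * h2 Lambda phi t x.
Proof.
have -> : h1 Lambda phi t x - 2 * h2 Lambda phi t x =
    (pdt Lambda t x - pdx Lambda t x) ^+ 2
    + (2 * sinh (Lambda t x) * (pdt phi t x - pdx phi t x)) ^+ 2.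
  by rewrite /h1 /h2; ring.
by rewrite addr_ge0 ?sqr_ge0.
Qed.

Lemma energy_integrand_le0 Lambda phi alpha t x :
  0 < alpha t x -> 0 < pdt alpha t x ->
  pdx alpha t x ^+ 2 - pdt alpha t x ^+ 2 < 0 ->
  energy_integrand Lambda phi alpha t x <= 0.
Proof.
move=> a0 at0 tl; rewrite /energy_integrand /kappa.
have [wm wp] := future_timelike_weights _ _ _ at0 tl.
apply: mulr_le0_ge0.
  by rewrite pmulr_rle0// invr_le0 ltW.
have := mulr_ge0 (ltW wm) (h1D2h2_ge0 Lambda phi t x).
have := mulr_ge0 (ltW wp) (h1B2h2_ge0 Lambda phi t x).
by lra.
Qed.

(** At [t = 0] joint continuity holds only from inside the half-plane; a
    horizontal slice never leaves it, so the slice is continuous in the usual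
    sense even on the boundary. *)
Lemma continuous_slice f t :
  {within half_plane, continuous (fun p : R * R => f p.1 p.2)} ->
  0 <= t -> continuous (f t).
Proof.
move=> /subspace_continuousP cf t0 x.
have pair_cvg (y : R) : (t, z) @[z --> y] --> (t, y).
  apply: (@cvg_pair _ _ _ (nbhs y) (nbhs t) (nbhs y)).
    exact: cvg_cst.
  exact: cvg_id.
apply: (cvg_trans _ (cf (t, x) t0)) => A nearA.
have := pair_cvg x _ nearA.
by apply: (@filterS _ (nbhs (x : R))) => y; apply.
Qed.

Lemma smooth_continuous_slices f t : smooth f -> 0 <= t ->
  [/\ continuous (f t), continuous (pdt f t) & continuous (pdx f t)].
Proof.
move=> /(_ 1%N)[cf [_ [ct _] [cx _]]] t0.
by split; exact: continuous_slice.
Qed.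

Lemma continuous_sinh : continuous (@sinh R).
Proof.
move=> x; apply: cvgMl; apply: cvgB; first exact: continuous_expR.
by apply: continuous_comp; [exact: opp_continuous|exact: continuous_expR].
Qed.

Lemma continuous_energy_integrand Lambda phi alpha t :
  smooth Lambda -> smooth phi -> smooth alpha -> 0 <= t ->
  (forall x, pdx alpha t x ^+ 2 - pdt alpha t x ^+ 2 != 0) ->
  continuous (energy_integrand Lambda phi alpha t).
Proof.
move=> sL sp sa t0 nz x.
have [cL cLt cLx] := smooth_continuous_slices _ _ sL t0.
have [_ cpt cpx] := smooth_continuous_slices _ _ sp t0.
have [ca cat cax] := smooth_continuous_slices _ _ sa t0.
have sq (g : R -> R) : continuous g -> continuous (fun y => g y ^+ 2).
  by move=> cg y; rewrite /continuous_at expr2; apply: cvgM; exact: cg.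
have c4s : continuous (fun y => 4 * sinh (Lambda t y) ^+ 2).
  move=> y; apply: cvgMr; apply: (sq (fun y => sinh (Lambda t y))) => z.
  by apply: continuous_comp; [exact: cL|exact: continuous_sinh].
apply: cvgM; first apply: cvgM; first exact: ca.
  apply: cvgV; first exact: nz.
  by apply: cvgB; exact: sq.
apply: cvgB; apply: cvgM; first exact: cat.
- apply: cvgD; first by apply: cvgD; exact: sq.
  by apply: cvgM; [exact: c4s|apply: cvgD; exact: sq].
- by apply: cvgMr; exact: cax.
- apply: cvgD; first by apply: cvgM; [exact: cLt|exact: cLx].
  by apply: cvgM; [exact: c4s|apply: cvgM; [exact: cpt|exact: cpx]].
Qed.

End Integrand.

Theorem theorem2p2 (R : realType) (Lambda phi alpha : R -> R -> R)
  (sol : smooth_solution Lambda phi alpha)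
  (alpha_gt0 : forall t x : R, 0 <= t -> 0 < alpha t x)
  (dt_alpha_gt0 : forall t x : R, 0 <= t -> 0 < pdt alpha t x)
  (alpha_timelike : forall t x : R, 0 <= t ->
     pdx alpha t x ^+ 2 - pdt alpha t x ^+ 2 < 0) :
  forall t : R, 0 <= t ->
    integral_well_defined lebesgue_measure [set: R]
      (fun x => (energy_integrand Lambda phi alpha t x)%:E) /\
    (0 <= energy Lambda phi alpha t)%E.
Proof.
case: sol => sL sp sa _ t t0.
have le0 x : ((energy_integrand Lambda phi alpha t x)%:E <= 0)%E.
  by rewrite lee_fin; apply: energy_integrand_le0; auto.
have pos0 : (\int[lebesgue_measure]_(x in [set: R])
    (fun x => (energy_integrand Lambda phi alpha t x)%:E)^\+ x = 0)%E.
  rewrite (eq_integral (cst 0%E)) ?integral0//.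
  by apply: le0_funeposE => x _; exact: le0.
split.
  split; last by left; rewrite pos0.
  apply/measurable_EFinP; apply: continuous_measurable_fun.
  apply: continuous_energy_integrand => // x.
  by rewrite lt_eqF// alpha_timelike.
rewrite /energy oppe_ge0 integralE pos0 sub0e.
by rewrite oppe_le0; exact: integral_ge0.
Qed.
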